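(* Let $G$ be a countably infinite discrete amenable group, let $G\curvearrowright Y$ be a free action by homeomorphisms on a compact metrizable space, and let $G\curvearrowright X$ be an extension of it, i.e. an action by homeomorphisms on a compact metrizable space $X$ together with a continuous $G$-equivariant surjection $X\to Y$. If $G\curvearrowright Y$ has URPC (the Uniform Rokhlin Property and comparison), then $G\curvearrowright X$ has URPC.
   Context: The following definitions are for a free action $G\curvearrowright Z$ on a compact metrizable space. A finite set $S\subset G$ is $(K,\varepsilon)$-invariant if $\left|\bigcap_{g\in K}gS\right|>(1-\varepsilon)|S|$. For $A\subset Z$ the upper Banach density is $\overline{D}(A)=\inf_F\sup_{z\in Z}\frac{|A\cap Fz|}{|F|}$, the infimum being over nonempty finite $F\subset G$. A tower is a pair $(S,V)$ with $S\subset G$ finite (the shape) and $V\subset Z$ open such that the sets $gV$, $g\in S$, are pairwise disjoint; $SV=\bigcup_{g\in S}gV$. A castle is a finite collection of towers $\{(S_i,V_i)\}_{i=1}^n$ with the sets $S_iV_i$ pairwise disjoint. URP: for every finite $K\subset G$ and every $\varepsilon>0$ there is a castle $\{(S_i,V_i)\}_{i=1}^n$ whose shapes are $(K,\varepsilon)$-invariant and such that $\overline{D}\left(Z\setminus\bigsqcup_{i=1}^nS_iV_i\right)<\varepsilon$. Comparison: for $A\subset Z$ closed and $B\subset Z$ open write $A\prec B$ if there are finitely many open sets $U_j$ covering $A$ and $g_j\in G$ such that the sets $g_jU_j$ are pairwise disjoint subsets of $B$. The action has comparison if $A\prec B$ whenever $A$ is closed, $B$ is open and $\mu(A)<\mu(B)$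 for every $G$-invariant Borel probability measure $\mu$ on $Z$. URPC means URP together with comparison. *)

(* Defs.v *)
From HB Require Import structures.
From mathcomp Require Import all_boot all_order all_algebra finmap.
From mathcomp Require Import all_classical all_reals all_analysis.

Set Implicit Arguments.
Unset Strict Implicit.
Unset Printing Implicit Defensive.

Import Order.TTheory GRing.Theory Num.Theory.

Local Open Scope classical_set_scope.
Local Open Scope ring_scope.

Section Groups.
Context (R : realType) (G : groupType).

(* [counting] is +oo on infinite sets; this only matters for K = fset0, where
   the intersection is all of G. *)
Definition invariant_shape (K : {fset G}) (e : R) (S : {fset G}) : Prop :=
  (((1 - e) * #|` S|%:R)%:E <
     @counting G R (\bigcap_(g in [set` K]) ((fun s => (g * s)%g) @` [set` S])))%E.

(* Folner's condition *)
Definition amenable : Prop :=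
  forall (K : {fset G}) (e : R), 0 < e ->
    exists2 S : {fset G}, S != fset0%fset & invariant_shape K e S.

End Groups.
Arguments amenable : clear implicits.

(* The Borel sigma-algebra of Z. The library's measurable types are pointed, so
   the (possibly empty) space Z is pointed by an explicit z0; the sigma-algebra
   does not depend on z0. *)
Definition pointed_at (Z : topologicalType) (z0 : Z) : Type := Z.
HB.instance Definition _ (Z : topologicalType) (z0 : Z) :=
  Topological.on (pointed_at z0).
HB.instance Definition _ (Z : topologicalType) (z0 : Z) :=
  isPointed.Build (pointed_at z0) z0.

Notation borel_type z0 := (g_sigma_algebraType (@open (pointed_at z0))).

Section Actions.
Context (R : realType) (G : groupType) (Z : topologicalType).
Implicit Types (a : G -> Z -> Z) (A B V : set Z) (S F : {fset G}).

(* Each [a g] is then a homeomorphism, with inverse [a g^-1]. *)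
Definition continuous_action a : Prop :=
  [/\ forall z, a 1%g z = z,
      forall g h z, a (g * h)%g z = a g (a h z) &
      forall g, continuous (a g)].

Definition free_action a : Prop := forall g z, a g z = z -> g = 1%g.

Definition upper_banach_density a A : \bar R :=
  ereal_inf [set ereal_sup
    [set (#|` [fset w in [fset a g z | g in F] | w \in A]%fset|%:R / #|` F|%:R)%:E
      | z in [set: Z]]
    | F in [set F : {fset G} | F != fset0%fset]].

Definition levels a S V : set Z := \bigcup_(g in [set` S]) (a g @` V).

Definition tower a S V : Prop :=
  open V /\ trivIset [set` S] (fun g => a g @` V).

Definition castle a n (S : 'I_n -> {fset G}) (V : 'I_n -> set Z) : Prop :=
  (forall i, tower a (S i) (V i)) /\
  trivIset [set: 'I_n] (fun i => levels a (S i) (V i)).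

Definition URP a : Prop :=
  forall (K : {fset G}) (e : R), 0 < e ->
    exists n (S : 'I_n -> {fset G}) (V : 'I_n -> set Z),
      [/\ castle a S V,
          forall i, invariant_shape K e (S i) &
          (upper_banach_density a
             (~` \bigcup_(i in [set: 'I_n]) levels a (S i) (V i)) < e%:E)%E].

Definition subequivalent a A B : Prop :=
  exists n (U : 'I_n -> set Z) (g : 'I_n -> G),
    [/\ forall j, open (U j),
        A `<=` \bigcup_(j in [set: 'I_n]) U j,
        trivIset [set: 'I_n] (fun j => a (g j) @` U j) &
        forall j, a (g j) @` U j `<=` B].

Definition invariant_measure a (z0 : Z) (mu : probability (borel_type z0) R) :
    Prop :=
  forall g (A : set (borel_type z0)), measurable A -> mu (a g @^-1` A) = mu A.

Definition comparison a : Prop :=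
  forall A B, closed A -> open B ->
    (forall (z0 : Z) (mu : probability (borel_type z0) R),
       invariant_measure a mu -> (mu A < mu B)%E) ->
    subequivalent a A B.

Definition URPC a : Prop := URP a /\ comparison a.

End Actions.
Arguments upper_banach_density R {G Z} a A.
Arguments URP R {G Z} a.
Arguments comparison R {G Z} a.
Arguments URPC R {G Z} a.

(* Main.v *)
(* Pull a castle of Y back to X and compare A with B inside each tower. If
   mu(A) < mu(B) for all invariant mu, then by compactness (an invariant
   measure is extracted from empirical means) there are n and a closed
   neighbourhood A' of A such that every orbit segment along a sufficiently
   invariant shape S visits B at least |S|/(n+1) more times than A'. This excess
   leaves room, in each tower, for a further |S|/(n+1) full levels,
   whose union has larger measure than the remainder of the castle; comparison
   in Y embeds the remainder into those levels. What is left is to match, over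
   the base of a tower, closed sources with open targets when at each point
   there are at least as many targets as sources. This is possible whatever the
   dimension of the base: a source may use several targets, and points that lie
   in more sets of the cover used for a source also have more targets
   available. *)

Require Import Defs.
From HB Require Import structures.
From mathcomp Require Import all_boot all_order all_algebra finmap.
From mathcomp Require Import all_classical all_reals all_analysis.
From mathcomp Require Import measurable_realfun.
From mathcomp Require Import lra zify.

Set Implicit Arguments.
Unset Strict Implicit.
Unset Printing Implicit Defensive.

Import Order.TTheory GRing.Theory Num.Theory.
Import numFieldNormedType.Exports.

Local Open Scope classical_set_scope.
Local Open Scope ring_scope.

(** * Open sets in metric spaces *)

Lemma near_seq (I : eqType) (T : Type) (F : set_system T) (r : seq I)
    (Q : I -> T -> Prop) : Filter F ->
  (forall i, i \in r -> \near F, Q i F) -> \near F, forall i, i \in r -> Q i F.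
Proof.
move=> FF; elim: r => [|i r IH] Qr; first by near=> y.
have /IH {}IH : forall k, k \in r -> \near F, Q k F.
  by move=> k kr; apply: Qr; rewrite inE kr orbT.
have Qi : \near F, Q i F by apply: Qr; rewrite inE eqxx.
near=> y => k; rewrite inE => /predU1P[->|]; first by near: y.
by move: k; near: y.
Unshelve. all: by end_near. Qed.

Section MetricSpaces.
Context {R : realType} {X : metricType R}.
Implicit Types (A V : set X).

(** The function is the distance to the complement. Open sets become superlevel sets, whose
    thresholds can be moved. *)
Lemma open_pos_fun V : open V ->
  exists f : X -> R,
    [/\ continuous f, forall x, 0 <= f x & V = [set x | 0 < f x]].
Proof.
(* The whole space is treated apart: the default [inf set0 = 0] would give the zero function. *)
move=> oV; have [VT|/set0P [a0 Va0]] := eqVneq (~` V) set0.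
  exists (fun=> 1); split => //.
    by move=> x; exact: cvg_cst.
  rewrite -[LHS]setCK VT setC0; apply/seteqP; split => //= x _; exact: ltr01.
pose D x := [set mdist x y | y in ~` V].
have D0 x : D x !=set0 by exists (mdist x a0); exists a0.
have lD x : has_lbound (D x).
  by exists 0 => _ [y _ <-]; exact: mdist_ge0.
have Dge0 x : 0 <= inf (D x).
  by apply: lb_le_inf => // _ [y _ <-]; exact: mdist_ge0.
have lip x y : inf (D x) - inf (D y) <= mdist x y.
  rewrite lerBlDr -lerBlDl; apply: lb_le_inf => // _ [z Vz <-].
  rewrite lerBlDl (le_trans _ (metric_triangle x y z))//.
  by apply: ge_inf => //; exists z.
exists (inf \o D); split => //.
- move=> x; apply/cvgrPdist_lt => e e0; near=> y => /=.
  have xy : mdist x y < e.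
    near: y; have := nbhsx_ballx x e e0; rewrite ballEmdist; exact.
  apply: le_lt_trans xy.
  by rewrite ler_norml lip andbT lerNl opprB (le_trans (lip _ _))// metric_sym.
- apply/seteqP; split => x /=.
    move=> Vx; have : nbhs x V by exact: open_nbhs_nbhs.
    rewrite -nbhs_ballE => -[e /= e0 eV]; apply: (lt_le_trans e0).
    apply: lb_le_inf => // _ [y Vy <-]; rewrite leNgt; apply/negP => xy.
    by apply: Vy; apply: eV; rewrite ballEmdist.
  apply: contraPP => Vx; apply/negP; rewrite -leNgt.
  by apply: ge_inf => //; exists x => //; exact: mdistxx.
Unshelve. all: by end_near. Qed.

Lemma near_gt (T : topologicalType) (f : T -> R) (c : R) (x : T) :
  continuous f -> c < f x -> \forall y \near x, c < f y.
Proof. by move=> /(_ x)/cvgr_gt; exact. Qed.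

Lemma near_lt (T : topologicalType) (f : T -> R) (c : R) (x : T) :
  continuous f -> f x < c -> \forall y \near x, f y < c.
Proof. by move=> /(_ x)/cvgr_lt; exact. Qed.

End MetricSpaces.

(** * Matching closed sources with open targets *)

Section Matching.
Context {R : realType} {X : metricType R} {I : eqType} {J : finType}.

(** A closed set that misses [x] misses a neighbourhood of [x], and [r] is finite. *)
Lemma near_count_le (P : I -> set X) (r : seq I) (x : X) :
  (forall i, closed (P i)) ->
  \forall y \near x, (count (fun i => `[< P i y >]) r <=
                      count (fun i => `[< P i x >]) r)%N.
Proof.
move=> cP.
have Px : \forall y \near x, forall i, i \in r -> P i y -> P i x.
  apply: near_seq => i _; have [Pix|Pix] := pselect (P i x).
    by near=> y.
  have : nbhs x (~` P i).
    by apply: open_nbhs_nbhs; split => //; exact: closed_openC.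
  by apply: filterS => y.
apply: filterS Px => y Px.
have -> : count (fun i => `[< P i y >]) r =
          count (predI (mem r) (fun i => `[< P i y >])) r.
  by apply: eq_in_count => i ir /=; rewrite ir.
by apply: sub_count => i /= /andP[ir /asboolP Py]; apply/asboolP; exact: Px.
Unshelve. all: by end_near. Qed.

(* The cover of [A i] stays inside [P i], so that targets are spent only where
   a source is dealt with. *)
Lemma matching_step (A N P : I -> set X) (i : I) (r : seq I) (U : J -> set X) :
  compact [set: X] -> closed (A i) -> open (N i) ->
  (forall k, closed (P k)) -> A i `<=` N i -> N i `<=` P i ->
  (forall j, open (U j)) ->
  (forall x, count (fun k => `[< P k x >]) (i :: r) <=
             #|[set j | `[< U j x >]]%SET|)%N ->
  exists W V : J -> set X,
    [/\ forall j, open (W j) /\ open (V j),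
        forall j, W j `<=` U j /\ V j `<=` U j,
        forall j x, W j x -> ~ V j x,
        A i `<=` \bigcup_j W j &
        forall x, (count (fun k => `[< P k x >]) r <=
                   #|[set j | `[< V j x >]]%SET|)%N].
Proof.
move=> cX cA oN cP AN NP oU hU.
have [b bP] := choice (fun j => open_pos_fun (oU j)).
have cb j : continuous (b j) by case: (bP j).
have bpos j x : U j x -> 0 < b j x by case: (bP j) => _ _ {1}->.
have posb j x : 0 < b j x -> U j x by move=> h; case: (bP j) => _ _ ->.
pose m x := count (fun k => `[< P k x >]) (i :: r).
(* The [T] such that [x] lies in [O T] form a chain of sets of targets at [x],
   of cardinality at least [m x]; hence closing up one target for each of them
   costs at most one more than the excess of targets over sources at [x]. *)
pose O (T : {set J}) : set X := [set x | [/\ N i x,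
  (forall t, t \in T -> 0 < b t x),
  (forall t t', t \in T -> t' \notin T -> b t' x < b t x) &
  (m x <= #|T|)%N]].
have oO T : open (O T).
  rewrite openE /interior => x [Nx bT bTT mT].
  have Nn : \near x, N i x by exact: open_nbhs_nbhs.
  have b0 : \forall y \near x, forall t, t \in T -> 0 < b t y.
    apply: filter_forall => t.
    have [tT|tT] := boolP (t \in T); last by near=> y.
    near=> y => _; near: y.
    by apply: near_gt => //; exact: bT.
  have b1 : \forall y \near x, forall t t',
      t \in T -> t' \notin T -> b t' y < b t y.
    apply: filter_forall => t; apply: filter_forall => t'.
    have [tT|tT] := boolP (t \in T); last by near=> y.
    have [t'T|t'T] := boolP (t' \notin T); last by near=> y.
    have : \forall y \near x, 0 < b t y - b t' y.
      apply: (near_gt (f := fun y => b t y - b t' y)).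
        by move=> y; apply: cvgB; exact: cb.
      by rewrite subr_gt0; exact: bTT.
    by apply: filterS => y; rewrite subr_gt0.
  have mn : \forall y \near x, (m y <= m x)%N by exact: near_count_le.
  near=> y; split; [by near: y|by near: y|by near: y|].
  by apply: leq_trans mT; near: y.
have [f fP] := choice (fun T => open_pos_fun (oO T)).
have cf T : continuous (f T) by case: (fP T).
have fpos T x : O T x -> 0 < f T x by case: (fP T) => _ _ {1}->.
have posf T x : 0 < f T x -> O T x by move=> h; case: (fP T) => _ _ ->.
have cover x : A i x -> exists T, 0 < f T x.
  move=> Ax; pose T := [set j | `[< U j x >]]%SET; exists T; apply: fpos; split.
  - exact: AN.
  - by move=> t; rewrite !inE => /bpos.
  - move=> t t'; rewrite !inE => /bpos tx /asboolP t'x.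
    by apply: le_lt_trans tx; rewrite leNgt; apply/negP => /posb.
  - exact: hU.
(* By compactness of [A i], one threshold [c] serves all its points. *)
have [c c0 cT] : exists2 c : R, 0 < c & forall x, A i x -> exists T, c < f T x.
  have cAc : compact (A i) by exact: (subclosed_compact cA cX).
  have := (compact_near_coveringP (A i)).1 cAc R (0^'+)
    (fun c x => exists T, c < f T x) _.
  have H : forall x, A i x ->
      \forall x' \near x & c \near 0^'+, exists T, c < f T x'.
    move=> x /cover[T fT].
    have n1 : \forall x' \near x, f T x / 2 < f T x'.
      by apply: near_gt => //; lra.
    have n2 : \forall c \near 0^'+, c < f T x / 2.
      by apply: nbhs_right_lt; lra.
    exists ([set x' | f T x / 2 < f T x'], [set c | c < f T x / 2]) => //.
    by move=> [x' c] /= [h1 h2]; exists T; exact: lt_trans h1.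
  move=> /(_ _ H) H'; near (0:R)^'+ => c; exists c => //.
  exact: (near H' c).
(* Each [T] is charged a single target [q T]. It is used for the source [i] where [f T] exceeds [c],
   and stays available to the other sources only where [f T] is below [c]; strictness on both sides
   keeps [W] and [V] open. *)
pose q (T : {set J}) := [pick t in T].
exists (fun j => [set x | exists T, q T = Some j /\ c < f T x]).
exists (fun j => U j `&` [set x | forall T, q T = Some j -> f T x < c]).
have qT T j x : q T = Some j -> 0 < f T x -> U j x.
  move=> + /posf[_ bT _ _]; rewrite /q; case: pickP => // t tT [<-].
  by apply: posb; exact: bT.
split.
- move=> j; split.
    rewrite openE /interior => x [T [qTj cx]].
    have n1 : \forall x' \near x, c < f T x'.
      exact: near_gt.
    by apply: filterS n1 => y cy; exists T.
  apply: openI => //; rewrite openE /interior => x /= xT.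
  apply: filter_forall => T.
  have [qTj|qTj] := pselect (q T = Some j); last by near=> y.
  near=> y => _; near: y.
  by apply: near_lt => //; exact: xT.
- move=> j; split; last by move=> x [].
  by move=> x [T [qTj cx]]; apply: (qT T) => //; exact: lt_trans cx.
- by move=> j x [T [qTj cx]] [_ /(_ T qTj)]; rewrite ltNge (ltW cx).
- move=> x Ax; have [T cTx] := cT x Ax.
  have [Nx bT _ mT] : O T x by apply: posf; exact: lt_trans cTx.
  have /card_gt0P[t0 t0T] : (0 < #|T|)%N.
    apply: leq_trans mT; rewrite /m /= (_ : `[< P i x >] = true)//.
    by apply/asboolP; exact: NP.
  case qTE : (q T) => [j|].
    by exists j => //; exists T.
  by move: qTE; rewrite /q; case: pickP => // /(_ t0); rewrite t0T.
- move=> x.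
  set B := [set j | `[< U j x >]]%SET.
  set B' := [set j | _]%SET.
  (* Outside [P i], hence outside [N i], no [O T] contains [x], so no target is lost. *)
  have [Pix|Pix] := pselect (P i x); last first.
    have -> : B' = B.
      apply/setP => j; rewrite !inE; apply/asbool_equiv_eq; split => [[]//|Ux].
      split => // T qTj; rewrite ltNge; apply/negP => cx.
      have : O T x by apply: posf; exact: lt_le_trans cx.
      by case=> /NP.
    by apply: leq_trans (hU x) => /=; rewrite leq_addl.
  pose TT := [set T : {set J} | `[< O T x >]]%SET.
  (* A target lost at [x] is [q T] for some [T] with [c <= f T x], so [x] lies in [O T]. *)
  have h1 : (#|B| <= #|B'| + #|TT|)%N.
    have sB : B \subset [set j | (j \in B') || (Some j \in q @: TT)]%SET.
      apply/fintype.subsetP => j; rewrite !inE => Ux.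
      have [|h] := boolP (Some j \in _); first by rewrite orbT.
      rewrite orbF; apply/asboolP; split => [|T qTj]; first by [].
      rewrite ltNge; apply/negP => cx; move/negP: h; apply.
      apply/imsetP; exists T; last by rewrite qTj.
      by rewrite !inE; apply: posf; exact: lt_le_trans cx.
    apply: leq_trans (subset_leq_card sB) _.
    have -> : [set j | (j \in B') || (Some j \in q @: TT)]%SET =
        (B' :|: [set j | Some j \in q @: TT])%SET.
      by apply/setP => j; rewrite !inE.
    apply: (leq_trans (leq_card_setU _ _)); rewrite leq_add2l.
    apply: (leq_trans _ (leq_imset_card q TT)).
    have SI : injective (@Some J) by move=> ? ? [].
      rewrite -(card_imset _ SI); apply/subset_leq_card/fintype.subsetP => z.
    by move=> /imsetP[j]; rewrite inE => + ->.
  (* Members of a chain have distinct cardinalities; here these lie between [m x] and [#|B|]. *)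
  have h2 : (#|TT| <= #|B|.+1 - m x)%N.
    have u : uniq [seq #|T : {set J}| | T <- enum TT].
      rewrite map_inj_in_uniq ?enum_uniq// => T T'.
      rewrite !mem_enum !inE => -[_ _ h _] [_ _ h' _] TT'.
      apply/eqP; rewrite eqEcard TT' leqnn andbT; apply: contrapT => /negP.
      move=> /fintype.subsetPn[t tT tT'].
      have : ~~ (T' \subset T)%SET.
        apply/negP => T'T; have /eqP TE : T' == T by rewrite eqEcard T'T TT' /=.
        by move: tT'; rewrite TE tT.
      move=> /fintype.subsetPn[t' t'T' t'T].
      by have := lt_trans (h _ _ tT t'T) (h' _ _ t'T' tT'); rewrite ltxx.
    have -> : #|TT| = size [seq #|T : {set J}| | T <- enum TT].
      by rewrite size_map cardE.
    rewrite -(size_iota (m x) (#|B|.+1 - m x)).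
    apply: uniq_leq_size => // _ /mapP[T + ->].
    rewrite mem_enum !inE => -[_ bT _ mT].
    rewrite mem_iota mT /=.
    have : (#|T| <= #|B|)%N.
      apply/subset_leq_card/fintype.subsetP => t /bT bt; rewrite !inE.
      exact: posb.
    by have := hU x; rewrite -/B -/(m x); lia.
  have h3 : m x = (count (fun k => `[< P k x >]) r).+1.
    by rewrite /m /= (_ : `[< P i x >] = true)//; exact/asboolP.
  by have := hU x; rewrite -/B -/(m x); move: h1 h2 h3; lia.
Unshelve. all: by end_near. Qed.

(** Induction on the sources: the targets left over by [matching_step] still suffice, at each point,
    for the remaining sources. *)
Lemma matching (A N P : I -> set X) (r : seq I) (U : J -> set X) :
  compact [set: X] -> uniq r ->
  (forall i, closed (A i)) -> (forall i, open (N i)) ->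
  (forall i, closed (P i)) -> (forall i, A i `<=` N i) ->
  (forall i, N i `<=` P i) -> (forall j, open (U j)) ->
  (forall x, count (fun i => `[< P i x >]) r <=
             #|[set j | `[< U j x >]]%SET|)%N ->
  exists W : I -> J -> set X,
    [/\ forall i j, i \in r -> open (W i j),
        forall i j, i \in r -> W i j `<=` U j,
        forall i i' j x, i \in r -> i' \in r -> W i j x -> W i' j x -> i = i' &
        forall i, i \in r -> A i `<=` \bigcup_j W i j].
Proof.
move=> cX + cA oN cP AN NP.
elim: r U => [|i r IH] U /=.
  by move=> _ _ _; exists (fun _ _ => set0); split => // i; rewrite in_nil.
move=> /andP[ir ur] oU hU.
have [W0 [V [oWV WVU WV AW hV]]] :=
  matching_step cX (cA i) (oN i) cP (AN i) (NP i) oU hU.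
have [W [oW WV' Winj AW']] := IH V ur (fun j => (oWV j).2) hV.
exists (fun k => if k == i then W0 else W k); split.
- move=> k j; rewrite inE; case: eqVneq => /= _ kr; last exact: oW.
  exact: (oWV j).1.
- move=> k j; rewrite inE; case: eqVneq => /= _ kr; first exact: (WVU j).1.
  by apply: (subset_trans (WV' _ _ kr)); exact: (WVU j).2.
- move=> k k' j x; rewrite !inE.
  case: eqVneq => /= [->|_]; case: eqVneq => /= [->|_] //;
    [move=> _ kr h1 h2|move=> kr _ h1 h2|].
  + by have := WV _ _ h1; case; exact: WV' h2.
  + by have := WV _ _ h2; case; exact: WV' h1.
  + exact: Winj.
- by move=> k; rewrite inE; case: eqVneq => [->//|_] /= kr; exact: AW'.
Qed.

End Matching.

(** * Borel measures from finitely additive means *)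

Section Regularization.
Context {R : realType} {X : metricType R} (lam : set X -> R).
Implicit Types (A E K L U V W : set X).

(** A limit of empirical means is only finitely additive. Suprema over closed sets from inside, then
    infima over open sets from outside, regularise it as in the Riesz representation theorem. *)
Definition inner_content U : \bar R :=
  ereal_sup [set (lam K)%:E | K in [set K | closed K /\ K `<=` U]].

Definition outer_content E : \bar R :=
  ereal_inf [set inner_content U | U in [set U | open U /\ E `<=` U]].

Lemma inner_content_ge K U : closed K -> K `<=` U ->
  ((lam K)%:E <= inner_content U)%E.
Proof. by move=> cK KU; apply: ereal_sup_ubound; exists K. Qed.

Lemma outer_content_le E U : open U -> E `<=` U ->
  (outer_content E <= inner_content U)%E.
Proof. by move=> oU EU; apply: ereal_inf_lbound; exists U. Qed.

Lemma outer_content_ge E (x : \bar R) :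
  (forall U, open U -> E `<=` U -> (x <= inner_content U)%E) ->
  (x <= outer_content E)%E.
Proof. by move=> h; apply: le_ereal_inf_tmp => _ [U [oU EU] <-]; exact: h. Qed.

Lemma le_outer_content : {homo outer_content : A E / A `<=` E >-> (A <= E)%E}.
Proof.
move=> A E AE; apply: outer_content_ge => U oU EU.
by apply: outer_content_le => //; exact: subset_trans EU.
Qed.

(** A homeomorphism preserving [lam] carries open neighbourhoods and closed subsets over. The
    reverse inequality follows by using the inverse homeomorphism. *)
Lemma outer_content_preimage_le (f g : X -> X) A : continuous f ->
  continuous g -> cancel f g -> cancel g f ->
  (forall E, lam (f @^-1` E) = lam E) ->
  (outer_content (f @^-1` A) <= outer_content A)%E.
Proof.
move=> cf cg fg gf lamf; apply: outer_content_ge => U oU AU.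
have ofU : open (f @^-1` U) by apply: open_comp => // x _; exact: cf.
apply: (@le_trans _ _ (inner_content (f @^-1` U))).
  by apply: outer_content_le => // x /AU.
apply: ge_ereal_sup => _ [K [cK KU] <-].
have -> : lam K = lam (g @^-1` K).
  by rewrite -[RHS]lamf; congr lam; apply/seteqP; split => x /=; rewrite fg.
apply: inner_content_ge.
  by apply: closed_comp => // x _; exact: cg.
by move=> x /KU /=; rewrite gf.
Qed.

Hypothesis lam_ge0 : forall A, 0 <= lam A.
Hypothesis lamU : forall A E, A `&` E = set0 -> lam (A `|` E) = lam A + lam E.

Let lam0 : lam set0 = 0.
Proof.
have := lamU (setI0 (set0 : set X)); rewrite setU0 => /eqP.
by rewrite -subr_eq subrr => /eqP <-.
Qed.

Let le_lam A E : A `<=` E -> lam A <= lam E.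
Proof.
move=> AE; have -> : E = A `|` (E `\` A) by rewrite setDUK.
by rewrite lamU ?lerDl// setDIK.
Qed.

Let lamU_le A E : lam (A `|` E) <= lam A + lam E.
Proof.
have -> : A `|` E = A `|` (E `\` A).
  by rewrite setDE setUIr setUv setIT.
by rewrite lamU ?setDIK// lerD2l; apply: le_lam => x [].
Qed.

Let inner_content_ge0 U : (0 <= inner_content U)%E.
Proof. by rewrite -[0%E]/(0%:E) -lam0; exact: inner_content_ge closed0 _. Qed.

Let outer_content_ge0 U : (0 <= outer_content U)%E.
Proof. exact: outer_content_ge. Qed.

Let inner_content_le U : (inner_content U <= (lam U)%:E)%E.
Proof.
by apply: ge_ereal_sup => _ [K [cK KU] <-]; rewrite lee_fin; exact: le_lam.
Qed.

Let outer_content_fin E : outer_content E \is a fin_num.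
Proof.
rewrite ge0_fin_numE//; apply: le_lt_trans (ltry (lam setT)).
apply: le_trans (inner_content_le _); exact: outer_content_le openT _.
Qed.

(** Points of [K] are sorted by which of two functions, positive exactly on [U] and on [V], is
    larger; the larger one is positive throughout [K]. *)
Let closed_split K U V : open U -> open V -> closed K -> K `<=` U `|` V ->
  exists K1 K2, [/\ closed K1 /\ closed K2, K1 `<=` U, K2 `<=` V &
                    K = K1 `|` K2].
Proof.
move=> oU oV cK KUV.
have [u [cu u0 UE]] := open_pos_fun oU.
have [v [cv v0 VE]] := open_pos_fun oV.
have cD : continuous (fun x => u x - v x).
  by move=> x; apply: cvgB; [exact: cu|exact: cv].
pose L := (fun x => u x - v x) @^-1` [set t | 0 <= t].
pose M := (fun x => u x - v x) @^-1` [set t | t <= 0].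
have uv x : K x -> 0 < u x \/ 0 < v x.
  by move=> /KUV; rewrite UE VE.
exists (K `&` L), (K `&` M); split.
- split; apply: closedI => //; apply: closed_comp => // x _ //; exact: cD.
- move=> x [/uv + /=]; rewrite /L UE /= subr_ge0 => -[//|vx uvx].
  exact: lt_le_trans uvx.
- move=> x [/uv + /=]; rewrite /M VE /= subr_le0 => -[ux uvx|//].
  exact: lt_le_trans uvx.
- rewrite -setIUr; apply/seteqP; split => [x Kx|x []//]; split => //.
  by rewrite /L /M /=; apply/orP; exact: le_total.
Qed.

Hypothesis X_compact : compact [set: X].

Let lam_le_sum (U : nat -> set X) n K : (forall k, open (U k)) -> closed K ->
  K `<=` \bigcup_(k < n) U k ->
  ((lam K)%:E <= \sum_(0 <= k < n) inner_content (U k))%E.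
Proof.
move=> oU; elim: n K => [|n IH] K cK KU.
  have -> : K = set0 by rewrite -subset0 => x /KU[].
  by rewrite lam0 big_geq.
have oUn : open (\bigcup_(k < n) U k) by exact: bigcup_open.
have [|K1 [K2 [[cK1 cK2] K1U K2U ->]]] := closed_split oUn (oU n) cK.
  move=> x /KU[k /= kn Ukx]; move: kn; rewrite ltnS leq_eqVlt.
  by move=> /predU1P[<-|kn]; [right|left; exists k].
rewrite big_nat_recr//= (@le_trans _ _ (lam K1 + lam K2)%:E)//.
  by rewrite lee_fin.
by rewrite EFinD leeD// ?IH// inner_content_ge.
Qed.

(** Compactness of [K] reduces the countable union to a finite one, where finite additivity of [lam]
    suffices. *)
Let inner_content_bigcup (U : nat -> set X) : (forall k, open (U k)) ->
  (inner_content (\bigcup_k U k) <= \sum_(0 <= k <oo) inner_content (U k))%E.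
Proof.
move=> oU; apply: ge_ereal_sup => _ [K [cK KU] <-].
have cptK : compact K := subclosed_compact cK X_compact (@subsetT _ K).
have := (compact_near_coveringP K).1 cptK nat \oo
  (fun n x => exists2 k, (k < n)%N & U k x) _.
have H : forall x, K x ->
    \forall x' \near x & n \near \oo, exists2 k, (k < n)%N & U k x'.
  move=> x /KU [k _ Ux]; exists (U k, [set n | (k < n)%N]).
    split => /=; first by apply: open_nbhs_nbhs; split.
    exact: nbhs_infty_gt.
  by move=> [x' n] /= [Ux' kn]; exists k.
move=> /(_ _ H) [n _ /(_ n) /= nK].
have {}nK : K `<=` \bigcup_(k < n) U k.
  by move=> x Kx; have [//|k kn Ukx] := nK _ x Kx; exists k.
by apply: le_trans (lam_le_sum oU cK nK) _; exact: nneseries_lim_ge.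
Qed.

Let outer_content0 : outer_content set0 = 0%E.
Proof.
apply/eqP; rewrite eq_le outer_content_ge0 andbT.
by rewrite -[0%E]/(0%:E) -lam0 (le_trans (outer_content_le open0 _)).
Qed.

Let outer_content_sigma_subadditive : sigma_subadditive outer_content.
Proof.
move=> F; apply/lee_addgt0Pr => e e0.
apply: le_trans (epsilon_trick _ (fun n => outer_content_ge0 (F n)) (ltW e0)).
have U_ex n : exists U, [/\ open U, F n `<=` U &
    (inner_content U <= outer_content (F n) + (e / (2 ^ n.+1)%:R)%:E)%E].
  have en : 0 < e / (2 ^ n.+1)%:R by rewrite divr_gt0// ltr0n expn_gt0.
  have [_ [U [oU FU] <-] hU] :=
    lb_ereal_inf_adherent en (outer_content_fin (F n)).
  by exists U; split => //; exact: ltW.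
have [U hU] := choice U_ex.
apply: (@le_trans _ _ (inner_content (\bigcup_n U n))).
  apply: outer_content_le; first by apply: bigcup_open => n _; case: (hU n).
  by move=> x [n _ Fx]; exists n => //; case: (hU n) => _ + _; exact.
apply: le_trans (inner_content_bigcup _) _; first by move=> n; case: (hU n).
by apply: lee_nneseries => // n _; case: (hU n).
Qed.

(** Removing from [W] a closed [K] inside [W] and [U] leaves an open set that contains the part of
    [W] outside [U]. Any closed [L] in it is disjoint from [K], so [lam] adds over [K] and [L]. *)
Let inner_content_split U W : open U -> open W ->
  (inner_content (W `&` U) + outer_content (W `&` ~` U) <= inner_content W)%E.
Proof.
move=> oU oW; rewrite -leeBrDr//; apply: ge_ereal_sup => _ [K [cK KWU] <-].
rewrite leeBrDr// -leeBrDl//.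
have oWK : open (W `&` ~` K) by apply: openI => //; exact: closed_openC.
apply: (@le_trans _ _ (inner_content (W `&` ~` K))).
  by apply: outer_content_le => // x [Wx Ux]; split => // /KWU[].
apply: ge_ereal_sup => _ [L [cL LWK] <-].
rewrite leeBrDl// -EFinD -lamU; last first.
  by rewrite -subset0 => x [Kx /LWK[]].
apply: inner_content_ge; first exact: closedU.
by move=> x [/KWU[]|/LWK[]].
Qed.

Let outer_content_caratheodory U E : open U ->
  (outer_content (E `&` U) + outer_content (E `&` ~` U) <= outer_content E)%E.
Proof.
move=> oU; apply: outer_content_ge => W oW EW.
apply: le_trans (inner_content_split oU oW); apply: leeD.
  by apply: outer_content_le; [exact: openI|exact: setSI].
by apply: le_outer_content; exact: setSI.
Qed.

Section Measure.
Variable x0 : X.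

Let T : pointedType := pointed_at x0.
Definition outer_content_at : set T -> \bar R := outer_content.

HB.instance Definition _ := isOuterMeasure.Build R T outer_content_at
  outer_content0 outer_content_ge0 le_outer_content
  outer_content_sigma_subadditive.

Let mu : set (borel_type x0) -> \bar R := outer_content_at.

Let borel_caratheodory (A : set (borel_type x0)) : measurable A ->
  measurable (A : set (caratheodory_type outer_content_at)).
Proof.
apply: smallest_sub.
  split => //; [by move=> E mE; rewrite setTD; exact: measurableC|].
  by move=> F mF; exact: bigcupT_measurable.
move=> U oU; apply: (le_caratheodory_measurable (mu := outer_content_at)).
by move=> E; exact: outer_content_caratheodory.
Qed.

Let mu_sigma_additive : semi_sigma_additive mu.
Proof.
move=> F mF tF mUF.
apply: (caratheodory_measure_sigma_additive (mu := outer_content_at)) => //.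
  by move=> i; exact: borel_caratheodory.
exact: borel_caratheodory.
Qed.

HB.instance Definition _ := isMeasure.Build _ (borel_type x0) R mu
  outer_content0 outer_content_ge0 mu_sigma_additive.

Hypothesis lamT : lam setT = 1.

Let mu_setT : mu setT = 1%E.
Proof.
apply/eqP; rewrite eq_le; apply/andP; split.
  rewrite (le_trans (outer_content_le openT _))//.
  by rewrite (le_trans (inner_content_le _))// lamT.
apply: outer_content_ge => U oU TU.
by rewrite -[1%E]/(1%:E) -lamT; exact: inner_content_ge.
Qed.

HB.instance Definition _ :=
  Measure_isProbability.Build _ (borel_type x0) R mu mu_setT.

Lemma borel_probability_exists : exists P : probability (borel_type x0) R,
  forall A, P A = outer_content A.
Proof. by exists mu. Qed.

End Measure.

End Regularization.

(** * Invariant shapes *)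

Section FolnerShapes.
Context {R : realType} {G : groupType}.
Implicit Types (K S : {fset G}) (e : R).

Let shape_core K S : set G :=
  \bigcap_(g in [set` K]) ((fun s => (g * s)%g) @` [set` S]).

(** As [1] is in [K], the intersection lies in [S]; it is therefore finite and [counting] is its
    cardinality. *)
Lemma shape_coreP K e S : 1%g \in K -> invariant_shape K e S ->
  exists C : {fset G}, [/\ (1 - e) * #|` S|%:R < #|` C|%:R,
    {subset C <= S} &
    forall g, g \in K -> {subset C <= [seq (g * s)%g | s <- S]}].
Proof.
move=> K1 iS; exists (fset_set (shape_core K S)).
have fC : finite_set (shape_core K S).
  apply: (@sub_finite_set _ _ [set` S]); last exact: finite_fset.
  by move=> t /(_ 1%g K1) [s sS]; rewrite mul1g => <-.
split.
- by move: iS; rewrite /invariant_shape /counting asboolT// lte_fin.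
- move=> t; rewrite in_fset_set// inE => /(_ 1%g K1) [s sS].
  by rewrite mul1g => <-.
- move=> g gK t; rewrite in_fset_set// inE => /(_ g gK) [s sS <-].
  exact: map_f.
Qed.

(** For empty [S] both sides of the strict inequality would be [0]. *)
Lemma invariant_shape_neq0 K e S : 1%g \in K -> invariant_shape K e S ->
  (0 < #|` S|)%N.
Proof.
move=> K1 /(shape_coreP K1)[C [hC CS _]]; rewrite lt0n; apply/negP => S0.
have C0 : (#|` C| <= #|` S|)%N by apply: uniq_leq_size => //; exact: fset_uniq.
by move: hC; move: C0; rewrite (eqP S0) leqn0 => /eqP ->; rewrite mulr0 ltxx.
Qed.

(** [S] and [g S] have the same size and share more than [(1 - e) |S|] elements, so fewer than
    [e |S|] elements of [g S] lie outside [S]. *)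
Lemma invariant_shape_shift K e S (g : G) (P : pred G) : 1%g \in K ->
  g \in K -> invariant_shape K e S ->
  (count (fun s => P (g * s)%g) S)%:R <= (count P S)%:R + e * #|` S|%:R.
Proof.
move=> K1 gK /(shape_coreP K1)[C [hC CS /(_ g gK) CL]].
have uS : uniq S by exact: fset_uniq.
have uC : uniq C by exact: fset_uniq.
set L := [seq (g * s)%g | s <- S] in CL.
have uL : uniq L by rewrite map_inj_uniq//; exact: mulgI.
have -> : count (fun s => P (g * s)%g) S = count P L by rewrite count_map.
have h1 : (#|` C| <= count (mem C) L)%N.
  rewrite -size_filter; apply: uniq_leq_size => // t tC.
  by rewrite mem_filter inE tC CL.
have h2 : (count (predI P (mem C)) L <= count P S)%N.
  rewrite -!size_filter; apply: uniq_leq_size; first exact: filter_uniq.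
  by move=> t; rewrite !mem_filter /= => /andP[/andP[-> tC] _]; rewrite CS.
have h3 : (count P L <= count (predI P (mem C)) L + count (predC (mem C)) L)%N.
  rewrite -size_filter -(count_predC (mem C)) !count_filter leq_add//.
    by apply: eq_leq; apply: eq_count => t /=; rewrite andbC.
  by apply: sub_count => t /= /andP[].
have h4 : (count (mem C) L + count (predC (mem C)) L = #|` S|)%N.
  by rewrite count_predC size_map.
have h5 : (count P L + #|` C| <= count P S + #|` S|)%N by lia.
have : ((count P L + #|` C|)%:R <= (count P S + #|` S|)%:R :> R).
  by rewrite ler_nat.
by rewrite !natrD; lra.
Qed.

Lemma invariant_shapeW K e1 e2 S : e1 <= e2 ->
  invariant_shape K e1 S -> invariant_shape K e2 S.
Proof.
move=> e12; apply: le_lt_trans; rewrite lee_fin ler_wpM2r// lerB//.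
Qed.

Lemma exhausting_shapes : countable [set: G] ->
  exists K : nat -> {fset G}, (forall n, 1%g \in K n) /\
    forall g, \forall n \near \oo, g \in K n.
Proof.
move=> /countable_injP[f finj].
pose B n := f @^-1` `I_n.+1.
have fB n : finite_set (B n).
  apply: finite_preimage; last exact: finite_II.
  by move=> x y _ _; apply: finj; rewrite inE.
exists (fun n => 1%g |` fset_set (B n))%fset; split=> [n|g].
  by rewrite in_fset1U eqxx.
near=> n; rewrite in_fset1U in_fset_set// [X in _ || X]mem_set ?orbT//=.
by near: n; exact: nbhs_infty_ge.
Unshelve. all: by end_near. Qed.

End FolnerShapes.

(** * Limits along ultrafilters *)

Section UltraLimits.
Context {R : realType}.

(** The image filter has a cluster point in the segment, and an ultrafilter converges to its cluster
    points. A single [F] thus gives limits for all subsets of the space at once. *)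
Lemma ultra_bounded_cvg (F : set_system nat) (u : nat -> R) :
  UltraFilter F -> (forall n, 0 <= u n <= 1) -> exists l : R, u @ F --> l.
Proof.
move=> UF u01; have FF : ProperFilter F := ultra_proper.
have /(_ (u @ F)) := @segment_compact R 0 1.
case; first by apply: nearW => n /=; rewrite in_itv /=.
move=> l [_ lc]; exists l => W lW /=.
have [//|FC] := in_ultra_setVsetC (u @^-1` W) UF.
by have [y [/= nW Wy]] := lc (~` W) W FC lW.
Qed.

End UltraLimits.

Section Hits.
Context {G : groupType} {Z : Type}.
Variable b : G -> Z -> Z.
Implicit Types (S : {fset G}) (A E : set Z).

Definition hits S (x : Z) E : nat := count (fun s => `[< E (b s x) >]) S.

Lemma hits_le S x A E : A `<=` E -> (hits S x A <= hits S x E)%N.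
Proof.
by move=> AE; apply: sub_count => s /= /asboolP h; apply/asboolP; exact: AE.
Qed.

End Hits.

(** * Counting along orbit segments *)

Section EmpiricalMeans.
Context {R : realType} {G : groupType} {X : metricType R}.
Variables (b : G -> X -> X) (K : nat -> {fset G}).
Hypothesis b_action : continuous_action b.
Hypothesis K1 : forall n, 1%g \in K n.
Hypothesis K_exhausts : forall g, \forall n \near \oo, g \in K n.

Section Limit.
Variables (S : nat -> {fset G}) (x : nat -> X).
Hypothesis S_invariant : forall n, invariant_shape (K n) (n.+1%:R^-1 : R) (S n).

Let emp n E : R := (hits b (S n) (x n) E)%:R / #|` S n|%:R.

Let S_gt0 n : 0 < #|` S n|%:R :> R.
Proof. by rewrite ltr0n; exact: invariant_shape_neq0 (S_invariant n). Qed.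

Let emp01 E n : 0 <= emp n E <= 1.
Proof.
by rewrite divr_ge0//= ler_pdivrMr// mul1r ler_nat; exact: count_size.
Qed.

(** [lam] is the limit of [emp] along an ultrafilter refining [\oo]. The last clause transfers
    eventual inequalities between counts, up to errors small relative to the shape; it also yields
    invariance. *)
Lemma limit_mean : exists lam : set X -> R,
  [/\ forall A, 0 <= lam A,
      forall A E, A `&` E = set0 -> lam (A `|` E) = lam A + lam E,
      lam setT = 1,
      forall g A, lam (b g @^-1` A) = lam A &
      forall A E, (forall e : R, 0 < e -> \forall n \near \oo,
        (hits b (S n) (x n) A)%:R <=
        (hits b (S n) (x n) E)%:R + e * #|` S n|%:R) -> lam A <= lam E].
Proof.
have [F [UF ooF]] := ultraFilterLemma (@eventually_filter).
have FF : ProperFilter F := ultra_proper.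
have [lam lamP] := choice (fun E => ultra_bounded_cvg UF (emp01 E)).
have lam_le A E : (forall e : R, 0 < e -> \forall n \near \oo,
    (hits b (S n) (x n) A)%:R <=
    (hits b (S n) (x n) E)%:R + e * #|` S n|%:R) -> lam A <= lam E.
  move=> AE; apply/ler_addgt0Pr => e e0.
  have cE : (fun n => emp n E + e) @ F --> lam E + e.
    by apply: cvgD; [exact: lamP|exact: cvg_cst].
  apply: (ler_cvg_to (lamP A) cE); apply: ooF.
  apply: filterS (AE _ e0) => n h.
  by rewrite ler_pdivrMr// mulrDl divfK// gt_eqF.
exists lam; split => //.
- move=> A; have c0 : (fun=> 0 : R) @ F --> (0 : R) by exact: cvg_cst.
  apply: (ler_cvg_to c0 (lamP A)).
  by apply: nearW => n; case/andP: (emp01 A n).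
- move=> A E AE; have cD := cvgD (lamP A) (lamP E).
  apply: (cvg_unique _ (lamP (A `|` E))) => //.
  suff <- : (fun n => emp n A + emp n E) = emp^~ (A `|` E) by exact: cD.
  apply/funext => n /=.
  rewrite /emp -mulrDl -natrD; congr (_%:R / _); rewrite /hits.
  rewrite -count_predUI [X in (_ + X)%N](_ : _ = 0%N) ?addn0.
    by apply: eq_count => s /=; rewrite -asbool_or.
  apply/eqP; rewrite -leqn0 leqNgt -has_count; apply/hasP => -[s _ /=].
  move=> /andP[/asboolP Ax /asboolP Ex].
  by have : (A `&` E) (b s (x n)) by []; rewrite AE.
- apply: (cvg_unique _ (lamP setT)) => //.
  suff -> : emp^~ setT = (fun=> 1) by exact: cvg_cst.
  apply/funext => n /=.
  rewrite /emp /hits (_ : count _ _ = #|` S n|) ?divff ?gt_eqF//.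
  by rewrite -[RHS]count_predT; apply: eq_count => s; apply/asboolP.
(* Once [g] is in [K n], translating the shape raises the count by at most [1 / n.+1] of its size.
   Applying this to [g^-1] gives equality. *)
- have le g A : lam (b g @^-1` A) <= lam A.
    apply: lam_le => e e0; near=> n.
    have gK : g \in K n by near: n.
    have := invariant_shape_shift (fun s => `[< A (b s (x n)) >]) (K1 n) gK
      (S_invariant n).
    have -> : count (fun s => `[< A (b (g * s)%g (x n)) >]) (S n) =
              hits b (S n) (x n) (b g @^-1` A).
      by apply: eq_count => s /=; case: b_action => _ -> _.
    move/le_trans; apply; rewrite lerD2l ler_pM2r// ltW//.
    by near: n; exact: (near_infty_natSinv_lt (PosNum e0)).
  move=> g A; apply/eqP; rewrite eq_le le /=.
  have {1}-> : A = b g^-1%g @^-1` (b g @^-1` A).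
    apply/seteqP; split => y /=;
      by case: b_action => b1 bM _; rewrite -bM mulgV b1.
  exact: le.
Unshelve. all: by end_near. Qed.

End Limit.

(** Otherwise every [n] has a bad shape and a bad point. Regularising a limit of their empirical
    means gives an invariant probability for which [B] is no larger than the zero set of [h]. *)
Lemma measure_gap (h : X -> R) (B : set X) : compact [set: X] ->
  continuous h -> (forall x, 0 <= h x) -> open B ->
  (forall (z0 : X) (mu : probability (borel_type z0) R),
     invariant_measure b mu -> (mu [set x | (h x <= 0)%R] < mu B)%E) ->
  exists n, forall S, invariant_shape (K n) (n.+1%:R^-1 : R) S -> forall x,
    (n.+1 * hits b S x [set y | (h y <= n.+1%:R^-1)%R] + #|` S| <=
     n.+1 * hits b S x B)%N.
Proof.
move=> cX ch h0 oB muAB; apply: contrapT => /forallNP gap.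
have {gap} /choice[Sx SxP] : forall n, exists Sx : {fset G} * X,
    invariant_shape (K n) (n.+1%:R^-1 : R) Sx.1 /\
    (n.+1 * hits b Sx.1 Sx.2 B <
     n.+1 * hits b Sx.1 Sx.2 [set y | (h y <= n.+1%:R^-1)%R] + #|` Sx.1|)%N.
  move=> n; have /existsNP[S /not_implyP[iS /existsNP[x /negP]]] := gap n.
  by rewrite -ltnNge => hSx; exists (S, x).
have [lam [lam0 lamU lamT lamb lam_le]] :=
  limit_mean (fun n => (Sx n).2) (fun n => (SxP n).1).
have [mu muE] := borel_probability_exists lam0 lamU cX (Sx 0).2 lamT.
have [b1 bM cb] := b_action.
have bK g : cancel (b g) (b g^-1%g) by move=> y; rewrite -bM mulVg b1.
have bVK g : cancel (b g^-1%g) (b g) by move=> y; rewrite -bM mulgV b1.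
have inv_mu : invariant_measure b mu.
  have le g A : (outer_content lam (b g @^-1` A) <= outer_content lam A)%E.
    apply: outer_content_preimage_le (cb g) (cb g^-1%g) (bK g) (bVK g) (lamb g).
  move=> g A mA; rewrite !muE; apply/eqP; rewrite eq_le le /=.
  have {1}-> : A = b g^-1%g @^-1` (b g @^-1` A).
    by apply/seteqP; split => y /=; rewrite bVK.
  exact: le.
have := muAB _ mu inv_mu; rewrite ltNge => /negP; apply; rewrite !muE.
apply: (@le_trans _ _ (inner_content lam B)); first exact: outer_content_le.
apply: outer_content_ge => W oW AW.
(* On the complement of [W], which is compact, [h] is positive and so bounded away from [0]. *)
have [m mW] : exists m : nat, [set y | h y <= m.+1%:R^-1] `<=` W.
  have cW : compact (~` W).
    by apply: (subclosed_compact _ cX) => //; exact: open_closedC.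
  have := (compact_near_coveringP _).1 cW nat \oo
    (fun m y => m.+1%:R^-1 < h y) _.
  have H y : (~` W) y -> \forall y' \near y & m \near \oo, m.+1%:R^-1 < h y'.
    move=> Wy; have hy : 0 < h y.
      by rewrite ltNge; apply/negP => /AW.
    exists ([set y' | h y / 2 < h y'], [set m | m.+1%:R^-1 < h y / 2]) => /=.
      split; first by apply: near_gt => //; lra.
      have hy2 : 0 < h y / 2 by lra.
      exact: (near_infty_natSinv_lt (PosNum hy2)).
    by move=> [y' m] /= [h1 h2]; exact: lt_trans h1.
  move=> /(_ _ H) [m _ /(_ m) /= mW]; exists m => y /= hy.
  by apply: contrapT => Wy; have := mW (leqnn m) y Wy; rewrite ltNge hy.
apply: (@le_trans _ _ (lam [set y | h y <= m.+1%:R^-1])%:E); last first.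
  apply: inner_content_ge => //.
  by apply: (closed_comp (fun z _ => ch z)) (@closed_le _ _).
apply: ge_ereal_sup => _ [L [cL LB] <-]; rewrite lee_fin.
(* For [n >= m] the failed gap bounds the visits to [B] by those to [h <= 1 / m.+1] plus
   [|S| / n.+1], and the last term is eventually below [e |S|]. *)
apply: lam_le => e e0; near=> n.
have [iS] := SxP n; set S := (Sx n).1; set y := (Sx n).2 => lt_hits.
have hitsL : (hits b S y L <= hits b S y B)%N by exact: hits_le.
have hitsm : (hits b S y [set y | (h y <= n.+1%:R^-1)%R] <=
              hits b S y [set y | (h y <= m.+1%:R^-1)%R])%N.
  apply: hits_le => z /= /le_trans; apply.
  rewrite lef_pV2 ?posrE ?ltr0n// ler_nat ltnS; near: n.
  exact: nbhs_infty_ge.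
have : (n.+1 * hits b S y L <=
        n.+1 * hits b S y [set y | (h y <= m.+1%:R^-1)%R] + #|` S|)%N.
  apply: (@leq_trans (n.+1 * hits b S y B)).
    by rewrite leq_mul2l hitsL orbT.
  apply: leq_trans (ltnW lt_hits) _; rewrite leq_add2r.
  by rewrite leq_mul2l hitsm orbT.
rewrite -(ler_nat R) natrD !natrM => hS.
have en : n.+1%:R^-1 < e :> R.
  by near: n; exact: (near_infty_natSinv_lt (PosNum e0)).
have n0 : 0 < n.+1%:R :> R by rewrite ltr0n.
have S0 : 0 <= #|` S|%:R :> R by [].
apply: (@le_trans _ _ ((hits b S y [set y | h y <= m.+1%:R^-1])%:R +
                       n.+1%:R^-1 * #|` S|%:R)).
  by rewrite -(ler_pM2l n0) mulrDr mulrA divff ?mul1r// gt_eqF.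
by rewrite lerD2l ler_wpM2r// ltW.
Unshelve. all: by end_near. Qed.

End EmpiricalMeans.

(** * Castles and extensions *)

Section Actions.
Context {R : realType} {G : groupType} {Z : topologicalType}.
Variable a : G -> Z -> Z.
Hypothesis a_action : continuous_action a.
Implicit Types (V : set Z) (S F : {fset G}).

Lemma actK g : cancel (a g) (a g^-1%g).
Proof. by case: a_action => a1 aM _ z; rewrite -aM mulVg a1. Qed.

Lemma actVK g : cancel (a g^-1%g) (a g).
Proof. by case: a_action => a1 aM _ z; rewrite -aM mulgV a1. Qed.

Lemma act_imageE g V : a g @` V = a g^-1%g @^-1` V.
Proof.
apply/seteqP; split => [_ [z Vz <-]|z Vz] /=; first by rewrite actK.
by exists (a g^-1%g z) => //; rewrite actVK.
Qed.

Lemma open_act_image g V : open V -> open (a g @` V).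
Proof.
move=> oV; rewrite act_imageE; apply: open_comp => // z _.
by case: a_action => _ _; exact.
Qed.

(** The density counts points of [F z]; on a free orbit they correspond to the elements of [F],
    which [hits] counts. *)
Lemma orbit_card F z V : injective (a ^~ z) ->
  #|` [fset w in [fset a g z | g in F] | w \in V]%fset| = hits a F z V.
Proof.
move=> inj; rewrite /hits.
have -> : [fset w in [fset a g z | g in F] | w \in V]%fset =
    [fset a g z | g in [fset g in F | `[< V (a g z) >]]]%fset.
  apply/fsetP => w; rewrite !inE /=; apply/idP/idP.
    move=> /andP[/imfsetP[g /= gF ->]]; rewrite inE => Vg.
    by apply/imfsetP; exists g => //=; rewrite !inE gF; apply/asboolP.
  move=> /imfsetP[g /=]; rewrite !inE => /andP[gF /asboolP Vg ->].
  by rewrite (mem_set Vg) andbT; apply/imfsetP; exists g.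
rewrite card_imfset//= -size_filter; apply/perm_size/uniq_perm.
- exact: fset_uniq.
- by rewrite filter_uniq// fset_uniq.
- by move=> g; rewrite mem_filter !inE andbC.
Qed.

Lemma levels_sub S S' V V' : (forall g, g \in S -> g \in S') -> V `<=` V' ->
  levels a S V `<=` levels a S' V'.
Proof.
move=> SS VV z [g /= gS [v Vv <-]]; exists g; first exact: SS.
by exists v => //; exact: VV.
Qed.

Lemma castle_sub n (S T : 'I_n -> {fset G}) (V W : 'I_n -> set Z) :
  castle a S V -> (forall i g, g \in T i -> g \in S i) ->
  (forall i, open (W i)) -> (forall i, W i `<=` V i) -> castle a T W.
Proof.
move=> [tow triv] TS oW WV; split.
  move=> i; split => // g h /= gT hT [z [[v Wv vz] [w Ww wz]]].
  apply: (tow i).2 => /=; [exact: TS|exact: TS|].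
  by exists z; split; [exists v => //; exact: WV|exists w => //; exact: WV].
move=> i j _ _ [z [zi zj]]; apply: triv => //; exists z.
split; first exact: (levels_sub (@TS i) (@WV i)) zi.
exact: (levels_sub (@TS j) (@WV j)) zj.
Qed.

End Actions.

(** * Invariant measures of castles *)

Section CastleMeasure.
Context {R : realType} {G : groupType} {Z : topologicalType}.
Variable a : G -> Z -> Z.
Hypothesis a_action : continuous_action a.
Variables (z0 : Z) (mu : probability (borel_type z0) R).
Hypothesis mu_invariant : invariant_measure a mu.

Let borel_open (V : set Z) : open V -> measurable (V : set (borel_type z0)).
Proof. by move=> oV; exact: sub_sigma_algebra. Qed.

Let measurable_act g (C : set (borel_type z0)) :
  measurable C -> measurable (a g @^-1` C : set (borel_type z0)).
Proof.
move=> mC.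
have mag : measurable_fun setT (a g : borel_type z0 -> borel_type z0).
  apply: (@measurability _ _ (borel_type z0) (borel_type z0) setT _ open) => //.
  move=> _ [V oV <-]; rewrite setTI; apply: borel_open.
  by apply: open_comp => // z _; case: a_action => _ _; exact.
by rewrite -[X in measurable X]setTI; exact: mag.
Qed.

(** Integrate [hits a F z C] over [z]: by invariance each [g] in [F] contributes [mu C]. *)
Lemma mean_hits_bound (F : {fset G}) (C : set (borel_type z0)) (e : R) :
  (0 < #|` F|)%N -> measurable C ->
  (forall z, (hits a F z C)%:R <= e * #|` F|%:R) -> (mu C <= e%:E)%E.
Proof.
move=> F0 mC hC.
have FR : 0 < #|` F|%:R :> R by rewrite ltr0n.
have mind g : measurable_fun setT
    (fun z : borel_type z0 => (\1_(a g @^-1` C) z : R)%:E).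
  by apply/measurable_EFinP/measurable_indic; exact: measurable_act.
have sumC : (\sum_(g <- F) mu C =
    \int[mu]_z (\sum_(g <- F) (\1_(a g @^-1` C) z)%:E))%E.
  rewrite ge0_integral_sum//; apply: eq_bigr => g _.
  rewrite integral_indic// ?setIT; last exact: measurable_act.
  exact: esym (mu_invariant g mC).
have hitsE z :
    (\sum_(g <- F) (\1_(a g @^-1` C) z : R)%:E = (hits a F z C)%:R%:E)%E.
  rewrite sumEFin; congr (_%:E); rewrite /hits -sum1_count natr_sum.
  rewrite [RHS]big_mkcond; apply: eq_bigr => g _; rewrite indicE.
  by have -> : (z \in a g @^-1` C) = `[< C (a g z) >] by []; case: ifP.
have : (\sum_(g <- F) mu C <= (e * #|` F|%:R)%:E)%E.
  rewrite sumC; apply: (@le_trans _ _ (\int[mu]_z (e * #|` F|%:R)%:E)%E).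
    apply: ge0_le_integral => //.
    - by move=> z _; rewrite hitsE.
    - exact: emeasurable_sum.
    - by move=> z _; rewrite hitsE lee_fin.
  rewrite integral_cst// [X in (_ * X)%E](_ : _ = 1%E) ?mule1//.
  exact: probability_setT.
have muC : mu C \is a fin_num by exact: fin_num_measure.
rewrite -(fineK muC) sumEFin !lee_fin big_const_seq count_predT iter_addr_0.

by rewrite -[X in X <= _]mulr_natr ler_pM2r.
Qed.

Lemma castle_measure n (S : 'I_n -> {fset G}) (V : 'I_n -> set Z) :
  castle a S V ->
  mu (\bigcup_(i in [set: 'I_n]) levels a (S i) (V i)) =
  (\sum_(i < n) #|` S i|%:R * fine (mu (V i)))%:E.
Proof.
move=> [tow triv].
have mV i g : measurable (a g @` V i : set (borel_type z0)).
  by apply: borel_open; apply: open_act_image => //; case: (tow i).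
have mL i : measurable (levels a (S i) (V i) : set (borel_type z0)).
  by apply: fin_bigcup_measurable.
have muV i g : mu (a g @` V i) = mu (V i).
  rewrite act_imageE//; apply: mu_invariant.
  by apply: borel_open; case: (tow i).
have muL i : mu (levels a (S i) (V i)) = (#|` S i|%:R * fine (mu (V i)))%:E.
  rewrite (measure_fin_bigcup mu)//; last by case: (tow i).
  rewrite fsbig_finite//= set_fsetK (eq_bigr (fun=> mu (V i)))//.
  rewrite -[in LHS](@fineK _ (mu (V i))) ?fin_num_measure//; last first.
    by apply: borel_open; case: (tow i).
  by rewrite sumEFin big_const_seq count_predT iter_addr_0 mulr_natl.
rewrite (measure_fin_bigcup mu)//; last exact: finite_finset.
rewrite (eq_fsbigr (fun i => (#|` S i|%:R * fine (mu (V i)))%:E)); last first.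
  by move=> i _; exact: muL.
rewrite -sumEFin [RHS]fsbig_seq ?index_enum_uniq//; apply: eq_fsbigl.
by apply/seteqP; split => i //= _; exact: mem_index_enum.
Qed.

End CastleMeasure.

(** * Pulling castles back along the factor map *)

Section Extension.
Context {R : realType} {G : groupType} {X Y : topologicalType}.
Variables (a : G -> Y -> Y) (b : G -> X -> X) (p : X -> Y).
Hypotheses (a_action : continuous_action a) (b_action : continuous_action b).
Hypothesis a_free : free_action a.
Hypothesis p_equivariant : forall g x, p (b g x) = a g (p x).

Lemma preimage_act_image g V : b g @` (p @^-1` V) = p @^-1` (a g @` V).
Proof.
rewrite !act_imageE//; apply/seteqP; split => x /=;
  by rewrite p_equivariant.
Qed.

Lemma preimage_levels S V : levels b S (p @^-1` V) = p @^-1` levels a S V.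
Proof.
rewrite /levels preimage_bigcup; apply: eq_bigcupr => g _.
exact: preimage_act_image.
Qed.

Lemma free_orbit_inj y : injective (a ^~ y).
Proof.
move=> g h /(congr1 (a h^-1%g)); case: (a_action) => a1 aM _.
rewrite -!aM mulVg a1 => /a_free/(congr1 (fun k => (h * k)%g)) /=.
by rewrite mulgA mulgV mul1g mulg1.
Qed.

(** For fixed [F] the fraction at [x] equals the fraction at [p x], so the supremum over [X] runs
    over values taken on [Y]. Orbits in [X] are free because their images are. *)
Lemma upper_banach_density_preimage V :
  (upper_banach_density R b (p @^-1` V) <= upper_banach_density R a V)%E.
Proof.
apply: le_ereal_inf_tmp => _ [F F0 <-].
apply: ereal_inf_le; eexists; first by exists F.
apply: ge_ereal_sup => _ [x _ <-].
apply: ereal_sup_ubound; exists (p x) => //.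
have bx : injective (b ^~ x).
  by move=> g h /(congr1 p); rewrite !p_equivariant; exact: free_orbit_inj.
rewrite (orbit_card _ _ bx) (orbit_card _ _ (@free_orbit_inj (p x))).
do 3 f_equal.
by apply: eq_count => g /=; rewrite p_equivariant.
Qed.

Lemma URP_extension : continuous p -> URP R a -> URP R b.
Proof.
move=> cp aURP K e e0; have [n [S [V [[tow triv] iS dens]]]] := aURP K e e0.
exists n, S, (fun i => p @^-1` V i); split => //.
- split=> [i|]; first split.
  + by apply: open_comp => [x _|]; [exact: cp|case: (tow i)].
  + move=> g h gS hS [x]; rewrite !preimage_act_image => -[xg xh].
    by apply: (tow i).2 gS hS _; exists (p x).
  + move=> i j _ _ [x]; rewrite !preimage_levels => -[xi xj].
    by apply: triv => //; exists (p x).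
- have -> : \bigcup_(i in [set: 'I_n]) levels b (S i) (p @^-1` V i) =
      p @^-1` (\bigcup_(i in [set: 'I_n]) levels a (S i) (V i)).
    rewrite preimage_bigcup; apply: eq_bigcupr => i _.
    exact: preimage_levels.
  by apply: le_lt_trans dens; exact: upper_banach_density_preimage.
Qed.

End Extension.

(** * Shrinking the bases of a castle *)

Section Castles.
Context {R : realType} {G : groupType} {Y : metricType R}.
Variable a : G -> Y -> Y.
Hypothesis a_action : continuous_action a.

(** [tower_matching] serves only base points where [f] is at least some [d > 0], so the bases must
    shrink while the remainder stays small. For one [y], the points of the finite set [F y] inside
    the castle stay inside for nearby points and small [d]; compactness makes [d] uniform. *)
Lemma castle_shrink n (S : 'I_n -> {fset G}) (f : 'I_n -> Y -> R)
    (F : {fset G}) (e : R) :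
  compact [set: Y] -> (forall i, continuous (f i)) ->
  (forall y, (hits a F y
     (~` \bigcup_(i in [set: 'I_n]) levels a (S i) [set v | 0 < f i v]))%:R <
    e) ->
  exists2 d : R, 0 < d & forall y, (hits a F y
     (~` \bigcup_(i in [set: 'I_n]) levels a (S i) [set v | d < f i v]))%:R < e.
Proof.
move=> cY cf hF.
pose rem d := ~` \bigcup_(i in [set: 'I_n]) levels a (S i) [set v | d < f i v].
have := (compact_near_coveringP _).1 cY R (0^'+)
  (fun d y => (hits a F y (rem d))%:R < e) _.
have H y : [set: Y] y -> \forall y' \near y & d \near 0^'+,
    (hits a F y' (rem d))%:R < e.
  move=> _.
  have stay : \forall q \near filter_prod (nbhs y) (0 : R)^'+,
      forall g, g \in F -> ~ rem 0 (a g y) -> ~ rem q.2 (a g q.1).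
    apply: near_seq => g gF.
    have [ry|/contrapT [i _ [s sS [v fv sv]]]] := pselect (rem 0 (a g y)).
      by near=> q => /(_ ry).
    (* This is [f i] at the point of the base from which level [s] reaches [a g y']. *)
    pose u y' := f i (a (s^-1 * g)%g y').
    have cu : continuous u.
      move=> z; apply: continuous_comp; last exact: cf.
      by case: a_action => _ _; exact.
    have [_ aM _] := a_action.
    have uy : 0 < u y by rewrite /u aM -sv actK.
    exists ([set y' | u y / 2 < u y'], [set d | d < u y / 2]) => /=.
      split; first by apply: near_gt => //; lra.
      by apply: nbhs_right_lt; lra.
    move=> [y' d] /= [h1 h2] _; apply; exists i => //; exists s => //.
    exists (a (s^-1 * g)%g y') => /=; first exact: lt_trans h1.
    by rewrite -aM mulgA mulgV mul1g.
  apply: filterS stay => -[y' d] /= stay; apply: le_lt_trans (hF y).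
  rewrite ler_nat /hits; rewrite -!size_filter.
  apply: uniq_leq_size => [|g]; first by rewrite filter_uniq// fset_uniq.
  rewrite !mem_filter => /andP[/asboolP rg gF]; rewrite gF andbT.
  apply/asboolT; apply: contrapT => h; exact: (stay g gF h).
move=> /(_ _ H) H'; near (0 : R)^'+ => d; exists d => // y.
exact: (near H' d).
Unshelve. all: by end_near. Qed.

End Castles.

(** * Matching inside a tower *)

Section TowerMatching.
Context {R : realType} {G : groupType} {X : metricType R}.
Variable b : G -> X -> X.
Hypothesis b_action : continuous_action b.

(* Over the base of a tower with shape [S], [inl s] stands for the level [s] cut
   down to [h <= 0] and [inr t] for the whole level [t]. *)
Lemma tower_matching (S T : {fset G}) (f h : X -> R) (B : set X) (d e : R) :
  compact [set: X] -> continuous f -> continuous h -> open B ->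
  0 < d -> 0 < e ->
  (forall x, (hits b S x [set y | (h y <= e)%R] + #|` T| <= hits b S x B)%N) ->
  exists W : G + G -> G -> set X,
    [/\ forall c j, open (W c j),
        forall c j x, W c j x -> [/\ j \in S, 0 < f x & B (b j x)],
        forall c c' j x, W c j x -> W c' j x -> c = c',
        forall s x, s \in S -> d <= f x -> h (b s x) <= 0 ->
          exists j, W (inl s) j x &
        forall t x, t \in T -> d <= f x -> exists j, W (inr t) j x].
Proof.
move=> cX cf ch oB d0 e0 hSB.
have [_ _ cb] := b_action.
(* The value [0] makes every condition on [k] vacuous for [inr t]. *)
pose k (c : G + G) x := if c is inl s then h (b s x) else 0.
have ck c : continuous (k c).
  case: c => [s|t] x; last exact: cvg_cst.
  by apply: continuous_comp; [exact: cb|exact: ch].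
have cle (u : X -> R) q : continuous u -> closed [set x | u x <= q].
  by move=> cu; apply: (closed_comp (fun z _ => cu z)) (@closed_le _ _).
have cge (u : X -> R) q : continuous u -> closed [set x | q <= u x].
  by move=> cu; apply: (closed_comp (fun z _ => cu z)) (@closed_ge _ _).
have olt (u : X -> R) q : continuous u -> open [set x | u x < q].
  by move=> cu; apply: (open_comp (fun z _ => cu z)) (@open_lt _ _).
have ogt (u : X -> R) q : continuous u -> open [set x | q < u x].
  by move=> cu; apply: (open_comp (fun z _ => cu z)) (@open_gt _ _).
(* Relaxing [d] to [d / 2] and [0] to [e] makes room for an open [N] between the closed sets [A] and
   [P], while [P] stays where [f] is positive and targets are available. *)
pose A c := [set x | d <= f x] `&` [set x | k c x <= 0].
pose N c := [set x | d / 2 < f x] `&` [set x | k c x < e].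
pose P c := [set x | d / 2 <= f x] `&` [set x | k c x <= e].
pose U (j : S) := [set x | 0 < f x] `&` (b (val j) @^-1` B).
pose r : seq (G + G) := map inl S ++ map inr T.
have ur : uniq r.
  rewrite cat_uniq !map_inj_uniq ?fset_uniq ?andbT//=; last 2 first.
  - by move=> ? ? [].
  - by move=> ? ? [].
  by apply/hasPn => _ /mapP[t _ ->]; apply/mapP => -[].
have := @matching R X (G + G)%type S A N P r U cX ur.
case=> //.
- by move=> c; apply: closedI; [exact: cge|exact: cle].
- by move=> c; apply: openI; [exact: ogt|exact: olt].
- by move=> c; apply: closedI; [exact: cge|exact: cle].
- by move=> c x [/= fx kx]; split => /=; lra.
- by move=> c x [/= fx kx]; split => /=; lra.
- move=> j; apply: openI; first exact: ogt.
  by apply: open_comp => // z _; exact: cb.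
(* Where [f < d / 2] there is no source. Elsewhere [f] is positive, the targets are exactly the
   visits to [B], and [hSB] applies. *)
- move=> x; have [fx|fx] := ltP (f x) (d / 2).
    rewrite (_ : count _ _ = 0%N)//; apply/eqP.
    rewrite -leqn0 leqNgt -has_count.
    by apply/hasP => -[c _ /asboolP[/=]]; lra.
  have -> : count (fun i => `[< P i x >]) r =
      (hits b S x [set y | (h y <= e)%R] + #|` T|)%N.
    rewrite count_cat !count_map; congr (_ + _)%N.
      apply: eq_count => s /=; apply/asbool_equiv_eq.
      by split => [[]|] //; split.
    rewrite -[RHS]count_predT; apply: eq_count => t /=; apply/asboolP.
    by split => //=; exact: ltW.
  apply: leq_trans (hSB x) _.
  have -> : #|[set j : S | `[< U j x >]]%SET| = hits b S x B; last by [].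
  rewrite /hits enum_fsetE count_map -size_filter cardE.
  apply/perm_size/uniq_perm => [||j].
  - exact: enum_uniq.
  - by rewrite filter_uniq// enum_uniq.
  rewrite [LHS]mem_enum [RHS]mem_filter mem_enum !inE andbT.
  apply/asbool_equiv_eq.
  by split => [[]|bB] //; split => //=; lra.
move=> W [oW WU Winj AW].
(* Targets are now indexed by [G] in place of the subtype [S]; sets with other indices are empty. *)
exists (fun c j =>
  [set x | exists j' : S, [/\ val j' = j, c \in r & W c j' x]]).
split.
- move=> c j; have [cr|cr] := boolP (c \in r); last first.
    rewrite (_ : [set x | _] = set0); first exact: open0.
    by apply/seteqP; split => // x [j' []].
  have -> : [set x | exists j' : S, [/\ val j' = j, true & W c j' x]] =
      \bigcup_(j' in [set j' : S | val j' = j]) W c j'.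
    apply/seteqP.
    by split => x; [move=> [j' [? _ ?]]|move=> [j' ? ?]]; exists j'.
  by apply: bigcup_open => j' _; exact: oW.
- move=> c j x [j' [<- cr /(WU _ _ cr)[fx Bx]]].
  by split => //; exact: valP.
- move=> c c' j x [j1 [j1j cr Wc]] [j2 [j2j c'r Wc']].
  apply: (Winj c c' j1 x) => //.
  by have -> : j1 = j2 by apply: val_inj; rewrite j1j.
- move=> s x sS fx hx; have sr : inl s \in r by rewrite mem_cat map_f.
  by have [j _ Wj] := AW _ sr x (conj fx hx); exists (val j), j.
- move=> t x tT fx; have tr : inr t \in r by rewrite mem_cat map_f ?orbT.
  by have [j _ Wj] := AW _ tr x (conj fx (lexx 0)); exists (val j), j.
Qed.

End TowerMatching.

(** * Comparison *)

Lemma subequivalent_fin (G : groupType) (Z : topologicalType)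
    (a : G -> Z -> Z) (A B : set Z)
    (T : finType) (U : T -> set Z) (g : T -> G) :
  (forall t, open (U t)) -> A `<=` \bigcup_(t in [set: T]) U t ->
  trivIset [set: T] (fun t => a (g t) @` U t) ->
  (forall t, a (g t) @` U t `<=` B) -> subequivalent a A B.
Proof.
move=> oU AU triv UB; exists #|T|, (U \o enum_val), (g \o enum_val).
split => //=.
- by move=> x /AU[t _ Ux]; exists (enum_rank t) => //=; rewrite enum_rankK.
- by move=> i j _ _ /triv-/(_ Logic.I Logic.I)/enum_val_inj.
Qed.

(** [(c + n) %/ n.+1] is the ceiling of [c / n.+1]; an integer difference that is at least the
    quotient is at least the ceiling. *)
Lemma ceil_div_count (n c alpha beta : nat) :
  (n.+1 * alpha + c <= n.+1 * beta -> alpha + (c + n) %/ n.+1 <= beta)%N.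
Proof.
move=> h; rewrite -ltnS -(ltn_pmul2l (ltn0Sn n)) mulnDr.
have := leq_trunc_div (c + n) n.+1; rewrite mulnC; move: h.
by rewrite !mulnS; lia.
Qed.

Lemma ceil_div_ge (n c : nat) : (c <= (c + n) %/ n.+1 * n.+1)%N.
Proof.
have := divn_eq (c + n) n.+1; have := ltn_pmod (c + n) (ltn0Sn n); lia.
Qed.

Lemma ceil_div_le (n c : nat) : ((c + n) %/ n.+1 <= c)%N.
Proof.
case: c => [|c]; first by rewrite add0n divn_small.
by rewrite -ltnS ltn_divLR// !mulSn mulnS; lia.
Qed.

Lemma fsubset_of_size (K : choiceType) (S : {fset K}) c : (c <= #|` S|)%N ->
  exists T : {fset K}, (forall s, s \in T -> s \in S) /\ #|` T| = c.
Proof.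
move=> cS; exists [fset s in take c S]%fset; split=> [s|].
  by rewrite !inE; exact: mem_take.
rewrite card_fseq undup_id ?take_uniq ?fset_uniq// size_takel//.
Qed.

(** * Comparison in the extension *)

Section ComparisonExtension.
Context {R : realType} {G : groupType} {X Y : metricType R}.
Variables (a : G -> Y -> Y) (b : G -> X -> X) (p : X -> Y).
Hypothesis G_countable : countable [set: G].
Hypotheses (X_compact : compact [set: X]) (Y_compact : compact [set: Y]).
Hypotheses (a_action : continuous_action a) (b_action : continuous_action b).
Hypothesis a_free : free_action a.
Hypothesis p_continuous : continuous p.
Hypothesis p_equivariant : forall g x, p (b g x) = a g (p x).

(** The remainder has measure at most [1 / (4 * n.+1)], so the castle has at least [3 / 4]. The
    levels in [T] carry at least [1 / n.+1] of the castle, hence at least [3 / (4 * n.+1)]. *)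
Lemma remainder_lt_levels n m (S T : 'I_m -> {fset G}) (V : 'I_m -> set Y)
    (F : {fset G}) (z0 : Y) (mu : probability (borel_type z0) R) :
  invariant_measure a mu -> castle a S V ->
  (forall i g, g \in T i -> g \in S i) ->
  (forall i, #|` S i| <= #|` T i| * n.+1)%N ->
  (0 < #|` F|)%N ->
  (forall y, (hits a F y
     (~` \bigcup_(i in [set: 'I_m]) levels a (S i) (V i)))%:R <=
     (4 * n.+1)%:R^-1 * #|` F|%:R :> R) ->
  (mu (~` \bigcup_(i in [set: 'I_m]) levels a (S i) (V i)) <
   mu (\bigcup_(i in [set: 'I_m]) levels a (T i) (V i)))%E.
Proof.
move=> mu_inv cS TS cardST F0 hF.
have oV i : open (V i) by case: cS => /(_ i) [].
have oL : open (\bigcup_(i in [set: 'I_m]) levels a (S i) (V i)).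
  apply: bigcup_open => i _; apply: bigcup_open => g _.
  exact: open_act_image.
have mL : measurable
    (\bigcup_(i in [set: 'I_m]) levels a (S i) (V i) : set (borel_type z0)).
  exact: sub_sigma_algebra.
have := mean_hits_bound a_action mu_inv F0 (measurableC mL) hF.
have -> : mu (~` \bigcup_(i in [set: 'I_m]) levels a (S i) (V i)) =
    (1 - mu (\bigcup_(i in [set: 'I_m]) levels a (S i) (V i)))%E.
  exact: probability_setC.
rewrite (castle_measure a_action mu_inv cS).
have cT : castle a T V := castle_sub cS TS oV (fun i => @subset_refl _ (V i)).
rewrite (castle_measure a_action mu_inv cT).
rewrite -EFinB !lee_fin lte_fin.
set s := \sum_(i < m) _; set t := \sum_(i < m) _ => hs.
have st : s <= n.+1%:R * t.
  rewrite /s /t mulr_sumr; apply: ler_sum => i _.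
  rewrite mulrA ler_wpM2r ?fine_ge0// -natrM ler_nat mulnC; exact: cardST.
have n1 : 1 <= n.+1%:R :> R by rewrite ler1n.
move: hs; rewrite natrM invfM => hs.
have : n.+1%:R * (1 - s) <= 4^-1 :> R.
  have n0 : 0 < n.+1%:R :> R by lra.
  rewrite -(ler_pM2l n0) in hs; apply: le_trans hs _.
  by rewrite mulrCA divff ?mulr1// gt_eqF.
nra.
Qed.

Lemma comparison_extension : URP R a -> comparison R a -> comparison R b.
Proof.
move=> aURP acomp A B cA oB muAB.
have [K [K1 Kex]] := exhausting_shapes G_countable.
have [h [ch h0 hE]] := open_pos_fun (closed_openC cA).
have AhE : A = [set x | h x <= 0].
  rewrite -[A]setCK hE; by apply/seteqP; split => x /=; rewrite leNgt => /negP.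
have [n gap] : exists n, forall S, invariant_shape (K n) (n.+1%:R^-1 : R) S ->
    forall x, (n.+1 * hits b S x [set y | (h y <= n.+1%:R^-1)%R] + #|` S| <=
      n.+1 * hits b S x B)%N.
  apply: (measure_gap b_action K1 Kex X_compact ch h0 oB).
  by rewrite -AhE.
have n0 : 0 < n.+1%:R^-1 :> R by rewrite invr_gt0 ltr0n.
(* One tolerance plays two roles: it is at most [1 / n.+1], as [gap] requires of the shapes, and it
   is the density that [remainder_lt_levels] allows. *)
have e0 : 0 < (4 * n.+1)%:R^-1 :> R by rewrite invr_gt0 ltr0n.
have [m [S [V [cS iS dens]]]] := aURP (K n) _ e0.
have {gap} gap i x : (hits b (S i) x [set y | (h y <= n.+1%:R^-1)%R] +
    (#|` S i| + n) %/ n.+1 <= hits b (S i) x B)%N.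
  apply: ceil_div_count; apply: gap; apply: invariant_shapeW (iS i).
  by rewrite lef_pV2 ?posrE ?ltr0n// ler_nat leq_pmull.
(* [T i] holds the reserved levels, as many as the excess in [gap]. *)
have [T TP] := choice (fun i => fsubset_of_size (ceil_div_le n #|` S i|)).
have oV i : open (V i) by case: cS => /(_ i) [].
have [f fP] := choice (fun i => open_pos_fun (oV i)).
have cf i : continuous (f i) by case: (fP i).
have VE i : V i = [set v | 0 < f i v] by case: (fP i).
have [F F0 densF] : exists2 F : {fset G}, (0 < #|` F|)%N & forall y, (hits a F y
    (~` \bigcup_(i in [set: 'I_m]) levels a (S i) [set v | 0 < f i v]))%:R <
    (4 * n.+1)%:R^-1 * #|` F|%:R :> R.
  move: dens; rewrite /upper_banach_density => /ereal_inf_lt[_ [F /= F0 <-] hF].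
  have {}F0 : (0 < #|` F|)%N by rewrite cardfs_gt0.
  exists F => // y; rewrite -ltr_pdivrMr ?ltr0n// -lte_fin.
  apply: le_lt_trans hF; apply: ereal_sup_ubound; exists y => //.
  rewrite (orbit_card _ _ (free_orbit_inj a_action a_free (y := y))).
  by under [in RHS]eq_bigcupr do rewrite -VE.
have [d d0 {}densF] := castle_shrink a_action Y_compact cf densF.
pose V' i := [set v | d < f i v].
have oV' i : open (V' i).
  by apply: (open_comp (fun z _ => cf i z)) (@open_gt _ _).
have V'V i : V' i `<=` V i by rewrite VE => v /=; exact: lt_trans.
have cS' : castle a S V' := castle_sub cS (fun i g gS => gS) oV' V'V.
pose rem := ~` \bigcup_(i in [set: 'I_m]) levels a (S i) (V' i).
pose Q := \bigcup_(i in [set: 'I_m]) levels a (T i) (V' i).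
have oL (S' : 'I_m -> {fset G}) :
    open (\bigcup_(i in [set: 'I_m]) levels a (S' i) (V' i)).
  apply: bigcup_open => i _; apply: bigcup_open => g _.
  exact: open_act_image.
have [k [U [gam [oU remU Utriv UQ]]]] : subequivalent a rem Q.
  apply: acomp => [||z0 mu mu_inv]; first exact: open_closedC.
    exact: oL.
  apply: (remainder_lt_levels (n := n) mu_inv cS' _ _ F0) => [i|i|y].
  - by case: (TP i).
  - by case: (TP i) => _ ->; exact: ceil_div_ge.
  - exact: ltW.
have WP i : exists W : G + G -> G -> set X,
    [/\ forall c j, open (W c j),
        forall c j x, W c j x -> [/\ j \in S i, 0 < f i (p x) & B (b j x)],
        forall c c' j x, W c j x -> W c' j x -> c = c',
        forall s x, s \in S i -> d <= f i (p x) -> h (b s x) <= 0 ->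
          exists j, W (inl s) j x &
        forall t x, t \in T i -> d <= f i (p x) -> exists j, W (inr t) j x].
  apply: (tower_matching (f := f i \o p) b_action X_compact _ ch oB d0 n0).
    by move=> x; apply: continuous_comp; [exact: p_continuous|exact: cf].
  by move=> x; case: (TP i) => _ ->.
have [W {}WP] := choice WP.
(* A single finite set containing all levels makes the index type of the pieces finite. *)
have [D DP] : exists D : {fset G}, forall i s, s \in S i -> s \in D.
  exists (fset_set (\bigcup_(i in [set: 'I_m]) [set` S i])) => i s sS.
  rewrite in_fset_set; first by apply/mem_set; exists i.
  by apply: bigcup_finite => //; exact: finite_finset.
have TD i t : t \in T i -> t \in D by case: (TP i) => TS _ /TS; exact: DP.
have WD i c j x : W i c j x -> j \in D by case: (WP i) => _ WPi _ _ _ /WPi[/DP].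
have [b1 bM cb] := b_action.
(* [(None, i, s, j)] sends part of the level [s] of the [i]-th tower into its
   level [j]; [(Some l, i, s, j)] sends the part of the remainder covered by
   [U l] that lands in the reserved level [s] on to the level [j]. *)
pose I := (option 'I_k * 'I_m * D * D)%type.
pose src (o : option 'I_k) (s : G) : G + G :=
  if o is Some _ then inr s else inl s.
pose mov (o : option 'I_k) (s : G) : G :=
  if o is Some l then (s^-1 * gam l)%g else s^-1%g.
pose dom (o : option 'I_k) : set X := if o is Some l then p @^-1` U l else setT.
have odom o : open (dom o).
  case: o => [l|]; last exact: openT.
  by apply: open_comp => // x _; exact: p_continuous.
pose piece (q : I) : set X := let: (o, i, s, j) := q in
  dom o `&` (b (mov o (val s)) @^-1` W i (src o (val s)) (val j)).
pose shift (q : I) : G := let: (o, i, s, j) := q in (val j * mov o (val s))%g.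
have pieceP q z : (b (shift q) @` piece q) z ->
    let: (o, i, s, j) := q in exists2 x, dom o x &
      let w := b (mov o (val s)) x in
      W i (src o (val s)) (val j) w /\ z = b (val j) w.
  case: q => [] [] [] o i s j /= [x [dx Wx] <-].
  by exists x => //; split => //; exact: bM.
apply: (subequivalent_fin (U := piece) (g := shift)).
- move=> [] [] [] o i s j; apply: openI => //.
  apply: open_comp => [x _|]; [exact: cb|by case: (WP i)].
- move=> x Ax; have hx : h x <= 0 by move: Ax; rewrite AhE.
  have [/remU[l _ Ux]|/contrapT[i _ [s /= sS [v V'v vx]]]] :=
    pselect (rem (p x)).
    (* [gam l] moves a point of the remainder over a reserved level [t], and [t^-1] brings it down
       over the base, where the matching of [inr t] takes over. *)
    have [i _ [t /= tT [v V'v vx]]] : Q (a (gam l) (p x)).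
      by apply: (UQ l); exists (p x).
    have pv : p (b (t^-1 * gam l)%g x) = v.
      by rewrite p_equivariant; case: a_action => _ -> _; rewrite -vx actK.
    have [_ _ _ _ Wt] := WP i; have := Wt t (b (t^-1 * gam l)%g x) tT.
    rewrite pv => /(_ (ltW V'v))[j Wj].
    by exists (Some l, i, FSetSub (TD _ _ tT), FSetSub (WD _ _ _ _ Wj)).
  have pv : p (b s^-1%g x) = v by rewrite p_equivariant -vx actK.
  have [_ _ _ Ws _] := WP i; have := Ws s (b s^-1%g x) sS.
  rewrite pv actVK// => /(_ (ltW V'v) hx)[j Wj].
  by exists (None, i, FSetSub (DP _ _ sS), FSetSub (WD _ _ _ _ Wj)).
(* The image point determines its piece. Disjointness in the castle gives the tower and the level
   [j], hence the point over the base; the matching then gives the source, and disjointness of the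
   translates of the [U l] gives [l]. *)
- move=> q1 q2 _ _ [z [/pieceP + /pieceP]].
  case: q1 => [] [] [] o1 i1 s1 j1; case: q2 => [] [] [] o2 i2 s2 j2 /=.
  move=> [x1 dx1 [W1 z1]] [x2 dx2 [W2 z2]].
  have [_ WP1 Winj _ _] := WP i1; have [j1S f1 _] := WP1 _ _ _ W1.
  have [_ WP2 _ _ _] := WP i2; have [j2S f2 _] := WP2 _ _ _ W2.
  (* Targets may lie over all of [V i], so the disjointness used is that of the castle before
     shrinking. *)
  have ii : i1 = i2.
    apply: cS.2 => //; exists (p z); split.
      rewrite z1 p_equivariant; exists (val j1) => //.
      by eexists; last by []; rewrite VE.
    rewrite z2 p_equivariant; exists (val j2) => //.
    by eexists; last by []; rewrite VE.
  subst i2.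
  have jj : val j1 = val j2.
    apply: (cS.1 i1).2 => //; exists (p z); split.
      by rewrite z1 p_equivariant; eexists; last by []; rewrite VE.
    by rewrite z2 p_equivariant; eexists; last by []; rewrite VE.
  have jj' : j1 = j2 by exact: val_inj.
  subst j2 => {jj}.
  have ww : b (mov o1 (val s1)) x1 = b (mov o2 (val s2)) x2.
    by apply: (can_inj (actK b_action (val j1))); rewrite -z1 -z2.
  have cc : src o1 (val s1) = src o2 (val s2).
    by apply: Winj W1 _; rewrite ww.
  have ss : s1 = s2.
    by apply: val_inj; move: cc; case: (o1) => [?|]; case: (o2) => [?|] //= [].
  subst s2.
  suff -> : o1 = o2 by [].
  clear W1 W2 z1 z2 f1 f2.
  case: o1 o2 dx1 dx2 ww cc => [l1|] [l2|] //= dx1 dx2 ww _.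
  congr Some; apply: Utriv => //; exists (a (gam l1) (p x1)); split.
    by exists (p x1).
  exists (p x2) => //; apply: (can_inj (actK a_action (val s1)^-1%g)).
  have [_ aM _] := a_action.
  by rewrite -!aM -!p_equivariant ww.
- move=> q z /pieceP; case: q => [] [] [] o i s j [x _ [Wx ->]].
  by have [_ WPi _ _ _] := WP i; have [] := WPi _ _ _ Wx.
Qed.

End ComparisonExtension.

Theorem corollary3p23 (R : realType) (G : groupType)
    (G_countably_infinite : ([set: G] #= [set: nat])%card)
    (G_amenable : amenable R G)
    (Y X : metricType R)
    (Y_compact : compact [set: Y]) (X_compact : compact [set: X])
    (a : G -> Y -> Y) (a_action : continuous_action a) (a_free : free_action a)
    (b : G -> X -> X) (b_action : continuous_action b)
    (p : X -> Y) (p_continuous : continuous p)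
    (p_surj : set_surj [set: X] [set: Y] p)
    (p_equivariant : forall g x, p (b g x) = a g (p x)) :
  URPC R a -> URPC R b.
Proof.
have G_countable : countable [set: G].
  by rewrite /countable (card_le_eql G_countably_infinite).
move=> [aURP acomp]; split.
  exact: URP_extension a_action b_action a_free p_equivariant p_continuous aURP.
exact: comparison_extension G_countable X_compact Y_compact a_action b_action
  a_free p_continuous p_equivariant aURP acomp.
Qed.
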